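(* Let $S=(P,L)$ and $S'=(P',L')$ be two generalized quadrangles of order $(2,2)$, and let $x\mapsto x'$ ($x\in P$, $x'\in P'$) be an isomorphism from $S$ to $S'$. Define the point-line geometry $\mathcal{S}=(\mathcal{P},\mathcal{L})$ by $$\mathcal{P}=\{(x,y')\in P\times P' : y'\in x'^{\perp}\},$$ and let $\mathcal{L}$ consist of all $3$-subsets $\{(x,u'),(y,v'),(z,w')\}$ of $\mathcal{P}$ such that $T=\{x,y,z\}$ is a set of three distinct points of $S$ which is either a line of $S$ or a complete triad of $S$, and $\{u',v',w'\}=T'^{\perp}$ (computed in $S'$, where $T'=\{x',y',z'\}$), with $u',v',w'$ distinct. Then $\mathcal{S}$ is a slim dense near hexagon with parameters $(s,t,t_2)=(2,5,\{1,2\})$.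
   Context: A partial linear space is a point-line geometry in which lines are subsets of the point set of size at least 2 and any two distinct points lie on at most one line; two distinct points are collinear ($x\sim y$) if some line contains both. For a point $x$, $x^{\perp}=\{x\}\cup\{y: y\sim x\}$; for a set $A$ of points, $A^{\perp}=\bigcap_{x\in A}x^{\perp}$. A generalized quadrangle of order $(2,2)$ is a partial linear space with every line of size $3$ and every point on $3$ lines such that for every point $x$ and line $l$ with $x\notin l$ there is a unique point of $l$ collinear with $x$ (it is unique up to isomorphism, with 15 points and 15 lines). A triad of $S$ is a set of three pairwise non-collinear points; it is complete if $|T^{\perp}|=3$ (otherwise $|T^{\perp}|=1$). Distance $d(x,y)$ is distance in the collinearity graph. A near polygon is a connected partial linear space of finite diameter such that for every point $x$ and line $l$ with $x\notin l$ there is a unique point of $l$ nearest to $x$; a near hexagon is one of diameter $3$. It is slim if every line has exactly $3$ points, and dense if any two points at distance $2$ have at least two common neighbours. Parameters $(s,t,t_2)$ mean: every line has $s+1$ points, every point lies on $t+1$ lines, and $t_2+1=|x^{\perp}\cap y^{\perp}|$ for points $x,y$ at distance $2$, where $t_2$ ranges over the listed set of values. *)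

(* Defs.v *)
From mathcomp Require Import all_boot.
Set Implicit Arguments. Unset Strict Implicit. Unset Printing Implicit Defensive.

Section Geometry.
Variable T : finType.
Implicit Types (L : {set {set T}}) (Pt A : {set T}) (x y : T).

Definition collinear L x y : bool :=
  (x != y) && [exists l in L, (x \in l) && (y \in l)].

Definition perp L x : {set T} := [set y | (y == x) || collinear L x y].

Definition perpS L A : {set T} := \bigcap_(x in A) perp L x.

Definition partial_linear_space Pt L : Prop :=
  (forall l, l \in L -> l \subset Pt /\ 2 <= #|l|) /\
  (forall l1 l2 x y, l1 \in L -> l2 \in L -> x != y ->
     x \in l1 -> y \in l1 -> x \in l2 -> y \in l2 -> l1 = l2).

Definition triad L A : bool :=
  (#|A| == 3) && [forall x in A, forall y in A, ~~ collinear L x y].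
Definition complete_triad L A : bool := triad L A && (#|perpS L A| == 3).

(* generalized quadrangle of order (2,2) whose point set is all of T
   (nonempty, as the paper's GQ(2,2) has 15 points) *)
Definition GQ22 L : Prop :=
  0 < #|T| /\
  partial_linear_space [set: T] L /\
  (forall l, l \in L -> #|l| = 3) /\
  (forall x, #|[set l in L | x \in l]| = 3) /\
  (forall x l, l \in L -> x \notin l ->
     exists! y, y \in l /\ collinear L x y).

Definition ball L (k : nat) x : {set T} :=
  iter k (fun B => B :|: [set y | [exists z in B, collinear L z y]]) [set x].

(* distance in the collinearity graph (meaningful when connected) *)
Definition dist L x y : nat := find (fun k => y \in ball L k x) (iota 0 #|T|.+1).

Definition connected_geom Pt L : Prop :=
  forall x y, x \in Pt -> y \in Pt -> exists k, y \in ball L k x.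

Definition near_hexagon Pt L : Prop :=
  partial_linear_space Pt L /\
  connected_geom Pt L /\
  (forall x y, x \in Pt -> y \in Pt -> dist L x y <= 3) /\
  (exists x y, [/\ x \in Pt, y \in Pt & dist L x y = 3]) /\
  (forall x l, x \in Pt -> l \in L -> x \notin l ->
     exists! y, y \in l /\ forall z, z \in l -> z != y -> dist L x y < dist L x z).

Definition slim L : Prop := forall l, l \in L -> #|l| = 3.

Definition dense Pt L : Prop :=
  forall x y, x \in Pt -> y \in Pt -> dist L x y = 2 ->
    2 <= #|perp L x :&: perp L y|.

Definition has_parameters Pt L (s t : nat) (ts2 : seq nat) : Prop :=
  (forall l, l \in L -> #|l| = s.+1) /\
  (forall x, x \in Pt -> #|[set l in L | x \in l]| = t.+1) /\
  (forall x y, x \in Pt -> y \in Pt -> dist L x y = 2 ->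
     (#|perp L x :&: perp L y|).-1 \in ts2) /\
  (forall t2, t2 \in ts2 -> exists x y, [/\ x \in Pt, y \in Pt, dist L x y = 2 &
     (#|perp L x :&: perp L y|).-1 = t2]).

End Geometry.

Definition geom_iso (P P' : finType) (L : {set {set P}}) (L' : {set {set P'}})
  (f : P -> P') : Prop :=
  bijective f /\ forall l : {set P}, (l \in L) = (f @: l \in L').

Section Construction.
Variables (P P' : finType) (L : {set {set P}}) (L' : {set {set P'}}) (f : P -> P').

Definition cPoints : {set P * P'} := [set p | p.2 \in perp L' (f p.1)].

Definition cLines : {set {set P * P'}} :=
  [set l : {set P * P'} | [&& l \subset cPoints, #|l| == 3,
     #|[set p.1 | p in l]| == 3,
     ([set p.1 | p in l] \in L) || complete_triad L [set p.1 | p in l],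
     #|[set p.2 | p in l]| == 3 &
     [set p.2 | p in l] == perpS L' (f @: [set p.1 | p in l])]].

End Construction.

(* Main.v *)
Require Import Defs.
From mathcomp Require Import all_boot.
Set Implicit Arguments. Unset Strict Implicit. Unset Printing Implicit Defensive.

(** In a generalized quadrangle of order (2,2) the number of points of a line not
    collinear with a given point is 0 or 2, so noncollinearity with a fixed point
    is additive along lines. A noncollinear pair [p], [q] and its common
    neighbours [x1], [x2], [x3] generate the quadrangle, hence noncollinearity
    with [p], [q], [x1], [x2] gives coordinates identifying the points with the
    nonzero vectors of the symplectic space F_2^4, collinearity being
    orthogonality. In these coordinates the points of the new geometry are the
    pairs (x, u) of orthogonal nonzero vectors, and its lines are the triples
    {(x, u), (y, v), (x + y, u + v)} with x <> y, u <> v, x orthogonal to v and y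
    orthogonal to u. The distance of (x, u) and (y, v) can be read off from
    <x, v> and <u, y>: it is 3 when these differ, 2 when both are 1, and at most
    2 when both are 0. The remaining claims are finite checks on these 105
    pairs. *)

(** * The symplectic space of dimension four over the field with two elements *)

Notation vec := (bool * bool * bool * bool)%type.

Definition vec0 : vec := (false, false, false, false).

Definition vadd (v w : vec) : vec :=
  let: (v1, v2, v3, v4) := v in let: (w1, w2, w3, w4) := w in
  (v1 (+) w1, v2 (+) w2, v3 (+) w3, v4 (+) w4).

(** The first two coordinates span one hyperbolic plane, the last two the other. *)
Definition symp (v w : vec) : bool :=
  let: (v1, v2, v3, v4) := v in let: (w1, w2, w3, w4) := w in
  (v1 && w2) (+) (v2 && w1) (+) (v3 && w4) (+) (v4 && w3).

Lemma sympDr v w1 w2 : symp v (vadd w1 w2) = symp v w1 (+) symp v w2.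
Proof.
case: v w1 w2 => [[[v1 v2] v3] v4] [[[a1 a2] a3] a4] [[[b1 b2] b3] b4] /=.
by rewrite !andb_addr; do 3 !(rewrite [RHS]addbACA; congr (_ (+) _)).
Qed.

Lemma cards3P (T : finType) (A : {set T}) :
  #|A| = 3 -> exists a b c, [/\ a != b, a != c, b != c & A = [set a; b; c]].
Proof.
move=> A3; have /card_gt0P[a aA] : 0 < #|A| by rewrite A3.
have A2 : #|A :\ a| == 2 by move: A3; rewrite (cardsD1 a) aA add1n => -[->].
have /cards2P[b [c [nbc E]]] := A2.
have /setD1P[nba _] : b \in A :\ a by rewrite E !inE eqxx.
have /setD1P[nca _] : c \in A :\ a by rewrite E !inE eqxx orbT.
exists a, b, c; split; rewrite // 1?eq_sym //.
by rewrite -(setD1K aA) E setUA.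
Qed.

Lemma card_set3 (T : finType) (a b c : T) :
  a != b -> a != c -> b != c -> #|[set a; b; c]| = 3.
Proof. by move=> ab ac bc; rewrite setUC cardsU1 !inE cards2 ab negb_or ![c == _]eq_sym ac bc. Qed.

(** * Coordinates for a generalized quadrangle of order (2,2) *)

Section Quadrangle.
Variables (P : finType) (L : {set {set P}}).
Hypothesis gqL : GQ22 L.

(** Noncollinearity is the relation that becomes the alternating form; it is false on the diagonal
    because [perp] contains its own point. *)
Definition ncol (x y : P) : bool := y \notin perp L x.

Definition on_line (x y z : P) : bool :=
  [&& x != y, x != z, y != z & [set x; y; z] \in L].

Lemma collinear_sym x y : collinear L x y = collinear L y x.
Proof.
rewrite /collinear eq_sym; congr (_ && _).
by apply/existsP/existsP => -[l /and3P[lL xl yl]]; exists l; rewrite lL xl yl.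
Qed.

Lemma ncolE x y : ncol x y = (x != y) && ~~ collinear L x y.
Proof. by rewrite /ncol inE negb_or eq_sym. Qed.

Lemma ncol_sym x y : ncol x y = ncol y x.
Proof. by rewrite !ncolE eq_sym collinear_sym. Qed.

Lemma ncolxx x : ncol x x = false.
Proof. by rewrite ncolE eqxx. Qed.

Lemma on_line_perm x y z : on_line x y z -> on_line y x z /\ on_line x z y.
Proof.
case/and4P=> xy xz yz l; rewrite /on_line ![_ == x]eq_sym xy xz yz [z == y]eq_sym yz.
by rewrite [[set y; x]]setUC l -setUA [[set z; y]]setUC setUA l.
Qed.

Lemma on_line_exists x y : x != y -> ~~ ncol x y -> exists z, on_line x y z.
Proof.
move=> xy; rewrite ncolE xy /= negbK => /andP[_ /existsP[l /and3P[lL xl yl]]].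
have [_ [_ [/(_ l lL) l3 _]]] := gqL.
have : #|l :\ x :\ y| == 1.
  by move: l3; rewrite (cardsD1 x) xl (cardsD1 y (l :\ x)) !inE eq_sym xy yl !add1n => -[->].
case/cards1P=> z E; exists z.
have: z \in l :\ x :\ y by rewrite E set11.
rewrite !inE => /and3P[zy zx zl]; rewrite /on_line xy ![_ == z]eq_sym zx zy /=.
have -> // : [set x; y; z] = l.
by rewrite -[RHS](setD1K xl) -(setD1K (_ : y \in l :\ x)) ?E ?setUA // !inE eq_sym xy.
Qed.

Lemma ncol_on_line x y z u : on_line x y z -> u \in [set x; y; z] -> ncol u x = false.
Proof.
case/and4P=> xy xz yz lL ul; rewrite ncolE /collinear.
case: eqVneq => //= _; apply/negbTE; rewrite negbK; apply/existsP.
by exists [set x; y; z]; rewrite lL ul !inE eqxx.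
Qed.

(* On a line missing [u] exactly one point is collinear with [u]; on a line
   through [u] all three are. In both cases an even number is not. *)
Lemma ncol_third x y z u : on_line x y z -> ncol u z = ncol u x (+) ncol u y.
Proof.
move=> xyz; have [yxz xzy] := on_line_perm xyz; have [_ yzx] := on_line_perm yxz.
have [zxy _] := on_line_perm xzy.
have [ul|ul] := boolP (u \in [set x; y; z]).
  rewrite (ncol_on_line xyz ul) (ncol_on_line yxz) ?(ncol_on_line zxy) //.
    by rewrite -setUA setUC.
  by rewrite [[set y; x]]setUC.
have lL : [set x; y; z] \in L by case/and4P: xyz.
have [_ [_ [_ [_ /(_ u _ lL ul)[w [[wl uw] wU]]]]]] := gqL.
move: (ul); rewrite !inE !negb_or !ncolE => /andP[/andP[-> ->] ->] /=.
have col v : v \in [set x; y; z] -> collinear L u v = (v == w).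
  move=> vl; apply/idP/eqP => [uv|->//]; exact/esym/wU.
rewrite !col ?inE ?eqxx ?orbT //.
case/and4P: xyz wl => /negbTE xy /negbTE xz /negbTE yz _.
have neqs := (eqxx, xy, xz, yz, etrans (eq_sym y x) xy, etrans (eq_sym z x) xz,
  etrans (eq_sym z y) yz).
by rewrite !inE => /orP[/orP[]|] /eqP->; rewrite !neqs.
Qed.

Lemma ncol_thirdl x y z u : on_line x y z -> ncol z u = ncol x u (+) ncol y u.
Proof. by move=> l; rewrite ![ncol _ u]ncol_sym (ncol_third u l). Qed.

Lemma no_triangle x y z u : on_line x y z ->
  ~~ ncol u x -> ~~ ncol u y -> u \in [set x; y; z].
Proof.
move=> xyz ux uy; apply: contraTT isT => ul.
have lL : [set x; y; z] \in L by case/and4P: xyz.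
have [_ [_ [_ [_ /(_ u _ lL ul)[w [_ wU]]]]]] := gqL.
move: ul ux uy; rewrite !inE !negb_or !ncolE => /andP[/andP[-> ->] _] /=.
rewrite !negbK => ux uy; case/and4P: xyz => /negP[]; apply/eqP.
by rewrite -(wU x) ?(wU y) //; rewrite !inE eqxx ?orbT.
Qed.

(* A hyperbolic pair together with its common neighbours generates the whole
   quadrangle. *)
Lemma span_ind (D : P -> Prop) p q x1 x2 :
  (forall x y z, on_line x y z -> D x -> D y -> D z) ->
  ncol p q -> D p -> D q ->
  (forall x, ~~ ncol p x -> ~~ ncol q x -> D x) ->
  x1 != x2 -> ~~ ncol p x1 -> ~~ ncol q x1 -> ~~ ncol p x2 -> ~~ ncol q x2 ->
  forall w, D w.
Proof.
move=> Dl pq Dp Dq Dx x12 px1 qx1 px2 qx2.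
(* Of the two further points on a line through [r], exactly one is collinear with [s]. It is a
   common neighbour of [r] and [s], and closure under lines gives the other. *)
have perpD r s : ncol r s -> D r -> (forall x, ~~ ncol r x -> ~~ ncol s x -> D x) ->
    forall w, ~~ ncol r w -> D w.
  move=> rs Dr H w rw; case: (eqVneq r w) => [<-//|r_w].
  have [z rwz] := on_line_exists r_w rw.
  have [_ rzw] := on_line_perm rwz.
  have rz : ~~ ncol r z by rewrite (ncol_third r rwz) ncolxx addFb.
  have := ncol_third s rwz; rewrite [ncol s r]ncol_sym rs.
  case sw: (ncol s w) => /= sz; last by apply: H; rewrite ?sw.
  by apply: Dl rzw Dr _; apply: H; rewrite ?sz.
have Dpp := perpD _ _ pq Dp Dx.
have Dqq w : ~~ ncol q w -> D w.
  by apply: (perpD q p) => //; [rewrite ncol_sym | move=> x qx px; apply: Dx].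
have Da a w : ~~ ncol p a -> ncol q a -> ~~ ncol a w -> D w.
  move=> pa qa; apply: (perpD a q) => [||x _]; [by rewrite ncol_sym | exact: Dpp | exact: Dqq].
(* The third point [a] of the line through [p] and [x] is collinear with [p] but not with [q], so
   [Da] covers its neighbours. By additivity these include every point noncollinear with both [p]
   and [x]. *)
have side x : ~~ ncol p x -> ~~ ncol q x -> p != x /\
    exists2 a, on_line p x a & forall w, ~~ ncol w a -> D w.
  move=> px qx; have p_x : p != x by apply: contraTneq pq => ->; rewrite ncol_sym.
  split=> //; have [a pxa] := on_line_exists p_x px; exists a => // w wa.
  apply: (Da a); last by rewrite ncol_sym.
    by rewrite (ncol_third p pxa) ncolxx addFb.
  by rewrite (ncol_third q pxa) [ncol q p]ncol_sym pq (negbTE qx).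
have [_ [a1 l1 D1]] := side _ px1 qx1; have [_ [a2 l2 D2]] := side _ px2 qx2.
move=> w; case pw: (ncol p w); last by apply: Dpp; rewrite pw.
have wp : ncol w p by rewrite ncol_sym.
case wx1: (ncol w x1); first by apply: D1; rewrite (ncol_third w l1) wp wx1.
case wx2: (ncol w x2); first by apply: D2; rewrite (ncol_third w l2) wp wx2.
(* Now [w] is collinear with [x1] and [x2] but not with [p]. The third point [z] of the line through
   [w] and [x1] is collinear neither with [p] nor, by [no_triangle], with [x2]; hence it is
   collinear with [a2]. *)
have w_x1 : w != x1 by apply: contraTneq pw => ->.
have [|z l] := on_line_exists w_x1 _; first by rewrite wx1.
have [l' _] := on_line_perm l; have [_ l''] := on_line_perm l'.
apply: Dl l'' (Dpp _ px1) (D2 z _).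
have pz : ncol p z by rewrite (ncol_third p l) pw (negbTE px1).
rewrite (ncol_third z l2) [ncol z p]ncol_sym pz; case zx2: (ncol z x2) => //=.
have [_ wzx] := on_line_perm l.
have := no_triangle (u := x2) wzx; rewrite ![ncol x2 _]ncol_sym wx2 zx2 !inE => /(_ isT isT).
case/orP=> [/orP[]|] /eqP E; first by rewrite -E (negbTE px2) in pw.
  by rewrite -E (negbTE px2) in pz.
by rewrite E eqxx in x12.
Qed.

Lemma lineP l x : l \in L -> x \in l ->
  exists y z, on_line x y z /\ l = [set x; y; z].
Proof.
move=> lL xl; have [_ [_ [/(_ l lL)/eqP l3 _]]] := gqL.
move: l3; rewrite (cardsD1 x) xl /= => /cards2P[y [z [yz E]]].
have : y \in l :\ x by rewrite E !inE eqxx.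
have : z \in l :\ x by rewrite E !inE eqxx orbT.
rewrite !inE => /andP[zx _] /andP[yx _]; exists y, z.
have El : l = [set x; y; z] by rewrite -(setD1K xl) E setUA.
by rewrite /on_line yz -El lL ![x == _]eq_sym zx yx.
Qed.

Lemma line_perp l x y : l \in L -> x \in l -> y \in l -> ~~ ncol x y.
Proof.
move=> lL xl yl; have [u [v [xuv E]]] := lineP lL xl.
by rewrite ncol_sym (ncol_on_line xuv) // -E.
Qed.

Lemma pencilP x : exists l1 l2 l3, [/\ l1 != l2, l1 != l3, l2 != l3 &
  forall l, (l \in L) && (x \in l) = (l \in [set l1; l2; l3])].
Proof.
have [_ [_ [_ [/(_ x)/cards3P[l1 [l2 [l3 [n12 n13 n23 E]]]] _]]]] := gqL.
by exists l1, l2, l3; split=> // l; rewrite -E inE.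
Qed.

(** Take two lines [l] and [m] meeting in [x], with [p] on [l] and [q] on [m] away from [x]. If [p]
    and [q] were collinear, [q] would lie on [l] and the lines would coincide. *)
Lemma ncol_exists : exists p q, ncol p q.
Proof.
have [/card_gt0P[p _] [[_ plsL] _]] := gqL.
have [l [l' [l'' [_ _ _ lE]]]] := pencilP p.
have /andP[lL pl] : (l \in L) && (p \in l) by rewrite lE !inE eqxx.
have [x [a [pxa El]]] := lineP lL pl.
have [m [mL xm ml]] : exists m, [/\ m \in L, x \in m & m != l].
  have [m1 [m2 [m3 [m12 _ _ mE]]]] := pencilP x.
  have /andP[? ?] : (m1 \in L) && (x \in m1) by rewrite mE !inE eqxx.
  have /andP[? ?] : (m2 \in L) && (x \in m2) by rewrite mE !inE eqxx orbT.
  by case: (eqVneq m1 l) => E; [exists m2; rewrite -E eq_sym | exists m1].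
have [q [b [xqb Em]]] := lineP mL xm.
exists p, q; apply: contraR ml => pq.
have qm : q \in m by rewrite Em !inE eqxx orbT.
have ql : q \in l.
  by rewrite El; apply: (no_triangle pxa); rewrite ?(line_perp mL qm xm) // ncol_sym.
have xq : x != q by case/and4P: xqb.
by apply/eqP/(plsL m l x q); rewrite // El !inE eqxx orbT.
Qed.

(** Each of the three lines through [p] carries exactly one point collinear with [q], and distinct
    lines share only [p]. *)
Lemma common_neighbours p q : ncol p q ->
  exists x1 x2 x3, [/\ x1 != x2, x1 != x3, x2 != x3 &
    forall x, ~~ ncol p x && ~~ ncol q x = (x \in [set x1; x2; x3])].
Proof.
move=> pq; have [_ [[_ plsL] _]] := gqL.
have qp : ncol q p by rewrite ncol_sym.
have contact l : (l \in L) && (p \in l) -> exists x,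
    [/\ x \in l, ~~ ncol q x, x != p & forall y, y \in l -> ~~ ncol q y -> y = x].
  case/andP=> lL pl; have [y [z [pyz ->]]] := lineP lL pl.
  have := ncol_third q pyz; rewrite qp.
  have [yp zp] : y != p /\ z != p by case/and4P: pyz; rewrite ![p == _]eq_sym.
  case qy: (ncol q y) => /= qz; [exists z|exists y]; rewrite !inE eqxx ?orbT ?qy ?qz.
    by split=> // w; rewrite !inE => /orP[/orP[]|] /eqP->; rewrite ?qp ?qy.
  by split=> // w; rewrite !inE => /orP[/orP[]|] /eqP->; rewrite ?qp ?qz.
have [l1 [l2 [l3 [l12 l13 l23 lE]]]] := pencilP p.
have l1E : (l1 \in L) && (p \in l1) by rewrite lE !inE eqxx.
have l2E : (l2 \in L) && (p \in l2) by rewrite lE !inE eqxx orbT.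
have l3E : (l3 \in L) && (p \in l3) by rewrite lE !inE eqxx orbT.
have [x1 [xl1 qx1 x1p U1]] := contact _ l1E.
have [x2 [xl2 qx2 x2p U2]] := contact _ l2E.
have [x3 [xl3 qx3 x3p U3]] := contact _ l3E.
have diff l m x y : (l \in L) && (p \in l) -> (m \in L) && (p \in m) -> l != m ->
    x \in l -> y \in m -> x != p -> x != y.
  case/andP=> lL pl /andP[mL pm] lm xl ym xp; apply: contraNneq lm => E.
  by apply/eqP/(plsL l m x p); rewrite // E.
exists x1, x2, x3; split.
- exact: (diff l1 l2).
- exact: (diff l1 l3).
- exact: (diff l2 l3).
move=> x; apply/andP/idP => [[px qx]|]; last first.
  case/andP: l1E l2E l3E => l1L pl1 /andP[l2L pl2] /andP[l3L pl3].
  rewrite !inE => /orP[/orP[]|] /eqP->; split=> //.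
  - exact: line_perp pl1 xl1.
  - exact: line_perp pl2 xl2.
  - exact: line_perp pl3 xl3.
have p_x : p != x by apply: contraNneq qx => <-.
have [z /and4P[_ _ _ lL]] := on_line_exists p_x px.
have xl : x \in [set p; x; z] by rewrite !inE eqxx orbT.
have : [set p; x; z] \in [set l1; l2; l3] by rewrite -lE lL !inE eqxx.
case/setUP=> [/set2P[]|/set1P] E; rewrite E in xl.
- by rewrite (U1 x) // !inE eqxx.
- by rewrite (U2 x) // !inE eqxx orbT.
- by rewrite (U3 x) // !inE eqxx orbT.
Qed.

(** Otherwise [y] would lie on the line through [p] and [x], where [x] is the only point collinear
    with [q]. *)
Lemma ncol_common_neighbours p q x y : ncol p q -> x != y ->
  ~~ ncol p x -> ~~ ncol q x -> ~~ ncol p y -> ~~ ncol q y -> ncol x y.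
Proof.
move=> pq xy px qx py qy.
have p_x : p != x by apply: contraNneq qx => <-; rewrite ncol_sym.
have [a pxa] := on_line_exists p_x px.
apply: contraTT isT => xy_perp.
have: y \in [set p; x; a] by apply: no_triangle pxa _ _; rewrite ncol_sym.
have qa := ncol_third q pxa.
rewrite [ncol q p]ncol_sym pq (negbTE qx) in qa.
rewrite !inE => /orP[/orP[]|] /eqP E.
- by move: qy; rewrite E ncol_sym pq.
- by rewrite E eqxx in xy.
- by move: qy; rewrite E qa.
Qed.

(** The value of [g] at [vec0] is unconstrained. *)
Definition coordinates (h : P -> vec) (g : vec -> P) : Prop :=
  [/\ forall u, h u != vec0, cancel h g, forall v, v != vec0 -> h (g v) = v &
      forall x y, (y \in perp L x) = ~~ symp (h x) (h y)].

Lemma coordinates_exist : exists h g, coordinates h g /\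
  forall x y z, on_line x y z -> h z = vadd (h x) (h y).
Proof.
have [p [q pq]] := ncol_exists.
have [x1 [x2 [x3 [x12 x13 x23 xE]]]] := common_neighbours pq.
have /andP[px1 qx1] : ~~ ncol p x1 && ~~ ncol q x1 by rewrite xE !inE eqxx.
have /andP[px2 qx2] : ~~ ncol p x2 && ~~ ncol q x2 by rewrite xE !inE eqxx orbT.
have /andP[px3 qx3] : ~~ ncol p x3 && ~~ ncol q x3 by rewrite xE !inE eqxx orbT.
have span D : (forall x y z, on_line x y z -> D x -> D y -> D z) ->
    [/\ D p, D q, D x1, D x2 & D x3] -> forall w, D w.
  move=> Dl [Dp Dq D1 D2 D3]; apply: (span_ind Dl pq Dp Dq _ x12) => //.
  move=> x px qx; have : x \in [set x1; x2; x3] by rewrite -xE px.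
  by rewrite !inE => /orP[/orP[]|] /eqP->.
have n12 : ncol x1 x2 by apply: (ncol_common_neighbours pq).
have n13 : ncol x1 x3 by apply: (ncol_common_neighbours pq).
have n23 : ncol x2 x3 by apply: (ncol_common_neighbours pq).
have sym := ncol_sym.
have eqs := (ncolxx, n12, n13, n23, pq, negbTE px1, negbTE qx1, negbTE px2,
  negbTE qx2, negbTE px3, negbTE qx3,
  (sym q p, sym x2 x1, sym x3 x1, sym x3 x2, sym x1 p, sym x1 q),
  (sym x2 p, sym x2 q, sym x3 p, sym x3 q)).
(* Every point is noncollinear with an even number of [x1], [x2], [x3]. This is additive along
   lines, so the five generators suffice; it expresses noncollinearity with [x3] through the four
   coordinates. *)
have regular u : ncol u x3 = ncol u x1 (+) ncol u x2.
  move: u; apply: span => [x y z l Dx Dy|]; last by rewrite !eqs.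
  rewrite !(ncol_thirdl _ l) Dx Dy.
  exact: addbACA.
(* In this order [p], [q] and [x1], [x2] become the two hyperbolic pairs of [symp]. *)
pose h u : vec := (ncol u p, ncol u q, ncol u x1, ncol u x2).
have hD x y z : on_line x y z -> h z = vadd (h x) (h y).
  by move=> l; rewrite /h /= !(ncol_thirdl _ l).
(* Both sides are additive in [v] along lines, so [v] may be taken among the generators; [regular]
   settles [x3]. *)
have sympE u v : ncol u v = symp (h u) (h v).
  move: v u; apply: span => [x y z l Dx Dy u|].
    by rewrite (ncol_third u l) Dx Dy (hD _ _ _ l) sympDr.
  split=> u; rewrite /h /= !eqs ?(andbT, andbF, addbF, addFb) //.
(* A point with zero coordinates would be collinear with or equal to every point, hence one of [x1],
   [x2], [x3], which are pairwise noncollinear. *)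
have hnz u : h u != vec0.
  apply/eqP => hu0; have nu v : ncol u v = false by rewrite sympE hu0.
  have: u \in [set x1; x2; x3] by rewrite -xE ![ncol _ u]sym !nu.
  rewrite !inE => /orP[/orP[]|] /eqP E; first by move: n12; rewrite -E nu.
    by move: n12; rewrite -E sym nu.
  by move: n13; rewrite -E sym nu.
have hinj : injective h.
  move=> u v huv; apply/eqP; apply: contraT => u_v.
  have [|z l] := on_line_exists u_v _.
    by rewrite sympE huv; case: (h v) => [[[[] []] []] []].
  case/eqP: (hnz z); rewrite (hD _ _ _ l) huv.
  by case: (h v) => [[[[] []] []] []].
have imD v w : (exists u, h u == v) -> (exists u, h u == w) ->
    v != w -> ~~ symp v w -> exists u, h u == vadd v w.
  move=> [x /eqP<-] [y /eqP<-]; rewrite (inj_eq hinj) -sympE => xy nxy.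
  by have [z l] := on_line_exists xy nxy; exists z; rewrite (hD _ _ _ l).
have im v : v != vec0 -> exists u, h u == v.
  (* The fifteen nonzero vectors are reached as the five generators, the six sums of [p] or [q] with
     one of [x1], [x2], [x3], and four further sums of orthogonal vectors. *)
  have ip : exists u, h u == (false, true, false, false).
    by exists p; rewrite /h !eqs.
  have iq : exists u, h u == (true, false, false, false).
    by exists q; rewrite /h !eqs.
  have i1 : exists u, h u == (false, false, false, true).
    by exists x1; rewrite /h !eqs.
  have i2 : exists u, h u == (false, false, true, false).
    by exists x2; rewrite /h !eqs.
  have i3 : exists u, h u == (false, false, true, true).
    by exists x3; rewrite /h !eqs.
  have ia1 := imD _ _ ip i1 isT isT; have ib1 := imD _ _ iq i1 isT isT.
  have ia2 := imD _ _ ip i2 isT isT; have ib2 := imD _ _ iq i2 isT isT.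
  have ia3 := imD _ _ ip i3 isT isT; have ib3 := imD _ _ iq i3 isT isT.
  have is1 := imD _ _ ia2 ib3 isT isT; have is2 := imD _ _ ia1 ib3 isT isT.
  have is3 := imD _ _ ia1 ib2 isT isT; have ir := imD _ _ i1 is1 isT isT.
  by case: v => [[[[] []] []] []].
(* The default [p] is taken only at [vec0]. *)
exists h, (fun v => odflt p [pick u | h u == v]); split=> //; split=> //.
- by move=> u; case: pickP => [v /eqP/hinj//|/(_ u)]; rewrite eqxx.
- move=> v /im[u huv]; case: pickP => [w /eqP//|/(_ u)]; by rewrite huv.
- by move=> x y; rewrite -sympE /ncol negbK.
Qed.

End Quadrangle.

(** * Flags of the symplectic space and finite checks on them *)

Lemma vaddC v w : vadd v w = vadd w v.
Proof.
by case: v w => [[[? ?] ?] ?] [[[? ?] ?] ?] /=; congr (_, _, _, _); rewrite addbC.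
Qed.

Lemma vaddK v w : vadd v (vadd v w) = w.
Proof.
by case: v w => [[[? ?] ?] ?] [[[? ?] ?] ?] /=; rewrite !addbA !addbb.
Qed.

Lemma sympC v w : symp v w = symp w v.
Proof. by case: v w => [[[[] []] []] []] [[[[] []] []] []]. Qed.

Lemma sympxx v : symp v v = false.
Proof. by case: v => [[[[] []] []] []]. Qed.

Lemma vadd_eq0 v w : (vadd v w == vec0) = (v == w).
Proof. by case: v w => [[[[] []] []] []] [[[[] []] []] []]. Qed.

Lemma sympDl v1 v2 w : symp (vadd v1 v2) w = symp v1 w (+) symp v2 w.
Proof. by rewrite ![symp _ w]sympC sympDr. Qed.

Definition vecs : seq vec :=
  let bs := [:: false; true] in
  [seq (x, d) | x <- [seq (y, c) | y <- [seq (a, b) | a <- bs, b <- bs], c <- bs], d <- bs].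

Lemma mem_vecs v : v \in vecs.
Proof. by case: v => [[[[] []] []] []]. Qed.

Notation flag := (vec * vec)%type.

Definition is_flag (x : flag) : bool :=
  [&& x.1 != vec0, x.2 != vec0 & ~~ symp x.1 x.2].

Definition flags : seq flag := [seq x <- [seq (v, w) | v <- vecs, w <- vecs] | is_flag x].

Definition fadd (x y : flag) : flag := (vadd x.1 y.1, vadd x.2 y.2).

(** Orthogonal first components will give a line of the quadrangle, nonorthogonal ones a complete
    triad. *)
Definition fadj (x y : flag) : bool :=
  [&& x.1 != y.1, x.2 != y.2, ~~ symp x.1 y.2 & ~~ symp x.2 y.1].

(** A closed formula, so that no search in the graph is needed; [fdist_eq0], [fdist_step] and
    [fdist_pred] identify it with the distance. *)
Definition fdist (x y : flag) : nat :=
  if symp x.1 y.2 (+) symp x.2 y.1 then 3 else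
  if symp x.1 y.2 then 2 else
  if x == y then 0 else if fadj x y then 1 else 2.

Lemma mem_flags x : (x \in flags) = is_flag x.
Proof.
rewrite mem_filter andb_idr // => _; apply/allpairsP; exists x.
by rewrite !mem_vecs; case: x.
Qed.

Lemma flags_uniq : uniq flags.
Proof. by vm_compute. Qed.

Lemma faddC x y : fadd x y = fadd y x.
Proof. by congr (_, _); rewrite vaddC. Qed.

Lemma faddK x y : fadd x (fadd x y) = y.
Proof. by rewrite /fadd /= !vaddK; case: y. Qed.

Lemma fadjC x y : fadj x y = fadj y x.
Proof.
rewrite /fadj [y.1 == _]eq_sym [y.2 == _]eq_sym [symp y.1 _]sympC [symp y.2 _]sympC.
by rewrite [~~ symp x.1 _ && _]andbC.
Qed.

Lemma fadj_irrefl x : fadj x x = false.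
Proof. by rewrite /fadj eqxx. Qed.

Lemma vaddKr_eq v w : (v == vadd v w) = (w == vec0).
Proof. by rewrite -vadd_eq0 vaddK. Qed.

(** The form vanishes on every first component against every second one, and bilinearity carries
    this over to the sums. *)
Lemma fadj_fadd x y : is_flag x -> is_flag y -> fadj x y ->
  is_flag (fadd x y) /\ fadj x (fadd x y).
Proof.
case/and3P=> x1 x2 /negbTE x12 /and3P[y1 y2 /negbTE y12] /and4P[xy1 xy2 /negbTE s12 /negbTE s21].
rewrite /is_flag /fadj /= !vadd_eq0 xy1 xy2 !vaddKr_eq y1 y2 !sympDl !sympDr.
by rewrite x12 y12 s12 [symp y.1 _]sympC s21 [symp x.2 x.1]sympC x12.
Qed.

(* The orthogonal of a plane is a plane, which has only three nonzero vectors. *)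
Lemma orth_plane v1 v2 w1 w2 w3 :
  v1 != vec0 -> v2 != vec0 -> v1 != v2 -> w1 != vec0 -> w2 != vec0 -> w1 != w2 ->
  w3 != vec0 -> w3 != w1 -> w3 != w2 ->
  ~~ symp v1 w1 -> ~~ symp v1 w2 -> ~~ symp v1 w3 ->
  ~~ symp v2 w1 -> ~~ symp v2 w2 -> ~~ symp v2 w3 -> w3 = vadd w1 w2.
Proof.
move=> n1 n2 n12 m1 m2 m12 m3 m31 m32 s11 s12 s13 s21 s22 s23.
pose orth v1 v2 := [seq w <- vecs | [&& w != vec0, ~~ symp v1 w & ~~ symp v2 w]].
have : all (fun v1 => all (fun v2 => all (fun w1 => all (fun w2 => all (fun w3 =>
    [|| v1 == vec0, v2 == vec0, v1 == v2, w1 == w2, w3 == w1, w3 == w2 |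
        w3 == vadd w1 w2]) (orth v1 v2)) (orth v1 v2)) (orth v1 v2)) vecs) vecs.
  by vm_compute.
move=> /allP/(_ v1 (mem_vecs _))/allP/(_ v2 (mem_vecs _))/allP/(_ w1).
rewrite mem_filter mem_vecs m1 s11 s21 => /(_ isT)/allP/(_ w2).
rewrite mem_filter mem_vecs m2 s12 s22 => /(_ isT)/allP/(_ w3).
rewrite mem_filter mem_vecs m3 s13 s23 => /(_ isT).
by rewrite (negbTE n1) (negbTE n2) (negbTE n12) (negbTE m12) (negbTE m31) (negbTE m32) => /eqP.
Qed.

Definition nbrs (x : flag) : seq flag := [seq y <- flags | fadj x y].

Lemma mem_nbrs x y : (y \in nbrs x) = fadj x y && is_flag y.
Proof. by rewrite mem_filter mem_flags. Qed.

Lemma fdist_eq0 x y : is_flag x -> is_flag y -> (fdist x y == 0) = (x == y).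
Proof.
move=> /and3P[_ _ /negbTE s] _; rewrite /fdist.
case: (eqVneq x y) => [<-|]; first by rewrite [symp x.2 _]sympC s.
by move=> _; do 3! [case: ifP => // _].
Qed.

Lemma fdist_fadj x y : fadj x y -> fdist x y = 1.
Proof.
move=> xy; case/and4P: (xy) => _ _ /negbTE s1 /negbTE s2; rewrite /fdist s1 s2 xy.
by case: eqVneq xy => // ->; rewrite fadj_irrefl.
Qed.

Lemma fdist_le3 x y : fdist x y <= 3.
Proof. by rewrite /fdist; do 4! [case: ifP => // _]. Qed.

Lemma fdist_step x y z : is_flag x -> is_flag y -> is_flag z -> fadj y z ->
  fdist x z <= (fdist x y).+1.
Proof.
rewrite -!mem_flags => xF yF zF yz.
have /allP/(_ y yF) : all (fun y => let ny := nbrs y in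
    all (fun x => all (fun z => fdist x z <= (fdist x y).+1) ny) flags) flags.
  by vm_compute.
by move=> /allP/(_ x xF)/allP; apply; rewrite mem_nbrs yz -mem_flags.
Qed.

Lemma fdist_pred x y k : is_flag x -> is_flag y -> fdist x y = k.+1 ->
  exists z, [/\ is_flag z, fadj z y & fdist x z = k].
Proof.
rewrite -!mem_flags => xF yF dxy.
have /allP/(_ y yF) : all (fun y => let ny := nbrs y in
    all (fun x => (fdist x y == 0) || has (fun z => (fdist x z).+1 == fdist x y) ny)
      flags) flags by vm_compute.
move=> /allP/(_ x xF)/orP[/eqP|/hasP[z]]; rewrite dxy // mem_nbrs fadjC.
by case/andP=> zy zF /eqP[dz]; exists z.
Qed.

(** This is the near polygon axiom in coordinates, checked by enumeration. *)
Lemma fdist_line x y z : is_flag x -> is_flag y -> is_flag z -> fadj y z ->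
  x \notin [:: y; z; fadd y z] ->
  let: (a, b, c) := (fdist x y, fdist x z, fdist x (fadd y z)) in
  [|| (a < b) && (a < c), (b < a) && (b < c) | (c < a) && (c < b)].
Proof.
rewrite -!mem_flags => xF yF zF yz nx.
have /allP/(_ y yF) : all (fun y => let ny := nbrs y in
    all (fun x => let a := fdist x y in
      all (fun z => (x \notin [:: y; z; fadd y z]) ==>
        let b := fdist x z in let c := fdist x (fadd y z) in
        [|| (a < b) && (a < c), (b < a) && (b < c) | (c < a) && (c < b)])
       ny) flags) flags by vm_compute.
by move=> /allP/(_ x xF)/allP/(_ z); rewrite mem_nbrs yz -mem_flags zF nx => /(_ isT).
Qed.

(* The line through [x] and [y] is also the line through [x] and [fadd x y];
   of these two neighbours we keep the one listed first. *)
Definition line_reps (x : flag) : seq flag :=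
  [seq y <- nbrs x | index y flags < index (fadd x y) flags].

(** Exchanging [y] and [fadd x y] pairs the neighbours of [x] along the lines through it; the six
    pairs give t + 1 = 6. *)
Lemma size_line_reps x : is_flag x -> size (line_reps x) = 6.
Proof.
rewrite -mem_flags => xF.
have /allP/(_ x xF)/eqP// : all (fun x => size (line_reps x) == 6) flags.
by vm_compute.
Qed.

Lemma size_common_nbrs x y : is_flag x -> is_flag y -> fdist x y = 2 ->
  size [seq z <- nbrs x | fadj y z] \in [:: 2; 3].
Proof.
rewrite -!mem_flags => xF yF dxy.
have /allP/(_ x xF)/allP/(_ y) : all (fun x => let nx := nbrs x in
    all (fun y => size [seq z <- nx | fadj y z] \in [:: 2; 3])
      [seq y <- flags | fdist x y == 2]) flags by vm_compute.
by apply; rewrite mem_filter dxy yF.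
Qed.

(** * Three-element sets, balls and distance, and orthogonals in coordinates *)

Lemma set3_rot (T : finType) (a b c : T) : [set a; b; c] = [set b; c; a].
Proof. by rewrite -setUA setUC. Qed.

Lemma set3_swap (T : finType) (a b c : T) : [set a; b; c] = [set b; a; c].
Proof. by rewrite [[set a; b]]setUC. Qed.

Lemma set3_neq (T : finType) (a b c : T) :
  #|[set a; b; c]| = 3 -> [/\ a != b, a != c & b != c].
Proof.
move=> E; split; apply: contra_eq_neq E => ->; last first.
- by rewrite -setUA setUid cards2; case: (a == c).
- by rewrite -set3_rot setUid cards2; case: (c == b).
- by rewrite setUid cards2; case: (b == c).
Qed.

Lemma imset_set3 (T U : finType) (f : T -> U) (a b c : T) :
  f @: [set a; b; c] = [set f a; f b; f c].
Proof. by rewrite !imsetU !imset_set1. Qed.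

Lemma in_perpS3 (T : finType) (L : {set {set T}}) (a b c x : T) :
  (x \in perpS L [set a; b; c]) = [&& x \in perp L a, x \in perp L b & x \in perp L c].
Proof.
apply/bigcapP/and3P => [H|[xa xb xc] i /setUP[/set2P[]|/set1P] -> //].
by split; apply: H; rewrite !inE eqxx ?orbT.
Qed.

(** Since [dist] tries only the radii from 0 to [#|T|], the bound on [n] ensures that the search
    reaches [n]. *)
Lemma dist_ball (T : finType) (L : {set {set T}}) (x y : T) (n : nat) :
  n <= #|T| -> (forall k, (y \in ball L k x) = (n <= k)) -> dist L x y = n.
Proof.
move=> nT ballE; rewrite /dist (eq_find ballE).
have n_in : has (leq n) (iota 0 #|T|.+1) by apply/hasP; exists n; rewrite ?mem_iota.
have lt_find := n_in; rewrite has_find size_iota in lt_find.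
apply/eqP; rewrite eqn_leq; apply/andP; split; last first.
  by have := nth_find 0 n_in; rewrite nth_iota.
rewrite leqNgt; apply/negP => lt_n; have := before_find 0 lt_n.
by rewrite nth_iota ?leqnn // ltnS.
Qed.

Section Ball.
Variables (T : finType) (L : {set {set T}}) (Pt : {set T}) (x : T) (d : T -> nat).
Hypothesis col_Pt : forall y z, collinear L y z -> z \in Pt.
Hypothesis xPt : x \in Pt.
Hypothesis d0 : forall y, y \in Pt -> (d y == 0) = (y == x).
Hypothesis d_step : forall y z, y \in Pt -> collinear L y z -> d z <= (d y).+1.
Hypothesis d_pred : forall y k, y \in Pt -> d y = k.+1 ->
  exists z, [/\ z \in Pt, collinear L z y & d z = k].

(** By [d_step] the value of [d] on a ball is at most the radius; by [d_pred] there is a path back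
    to [x]. Elements of [T] outside [Pt] never enter, by [xPt] and [col_Pt]. *)
Lemma in_ball k y : (y \in ball L k x) = (y \in Pt) && (d y <= k).
Proof.
elim: k y => [|k IH] y.
  rewrite inE leqn0; apply/eqP/andP => [->|[yPt]]; last by rewrite d0 // => /eqP.
  by rewrite d0 ?eqxx.
rewrite /ball iterS -/(ball L k x) !inE IH.
apply/orP/andP => [[/andP[-> /leqW//]|/existsP[z]]|[yPt]].
  rewrite IH => /andP[/andP[zPt dz] zy]; split; first exact: col_Pt zy.
  exact: leq_trans (d_step zPt zy) _.
rewrite leq_eqVlt ltnS => /orP[/eqP dy|dy]; [right|by left; rewrite yPt].
have [z [zPt zy dz]] := d_pred yPt dy.
by apply/existsP; exists z; rewrite IH zPt dz leqnn.
Qed.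

End Ball.

(** The left side is the orthogonal of the plane spanned by [x.1] and [y.1], and [orth_plane] leaves
    no nonzero vector in it besides the three displayed. *)
Lemma perpS_coordinates (P : finType) (L : {set {set P}}) h g x y :
  coordinates L h g -> is_flag x -> is_flag y -> fadj x y ->
  perpS L [set g x.1; g y.1; g (vadd x.1 y.1)] = [set g x.2; g y.2; g (vadd x.2 y.2)].
Proof.
move=> [hnz hK gK perpE] xF yF xy.
have [zF xz] := fadj_fadd xF yF xy.
have [_ yz] := fadj_fadd yF xF (etrans (fadjC _ _) xy).
case/and3P: (xF) => x1 x2 x12; case/and3P: (yF) => y1 y2 y12; case/and3P: zF => z1 z2 z12.
case/and4P: (xy) => xy1 xy2 s12 s21.
apply/setP => u; rewrite in_perpS3 !perpE !gK // !inE.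
have eqg w : w != vec0 -> (u == g w) = (h u == w).
  by move=> w0; apply/eqP/eqP => [->|<-]; rewrite ?gK ?hK.
rewrite !eqg // sympDl negb_add.
apply/and3P/idP => [[xu yu _]|].
  apply: contraT; rewrite !negb_or -andbA => /and3P[u1 u2 /eqP[]].
  by apply: (orth_plane (v1 := x.1) (v2 := y.1)) => //; rewrite sympC.
case/orP=> [/orP[]|] /eqP->; rewrite ?sympDr.
- by rewrite (negbTE x12) [symp y.1 _]sympC (negbTE s21).
- by rewrite (negbTE y12) (negbTE s12).
- by rewrite (negbTE x12) (negbTE y12) (negbTE s12) [symp y.1 _]sympC (negbTE s21).
Qed.

(** * The new geometry in coordinates *)

Section Construction.
Variables (P P' : finType) (L : {set {set P}}) (L' : {set {set P'}}) (f : P -> P').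
Variables (h : P -> vec) (g : vec -> P) (h' : P' -> vec) (g' : vec -> P').
Hypothesis gqL : GQ22 L.
Hypothesis coordL : coordinates L h g.
Hypothesis lineL : forall x y z, on_line L x y z -> h z = vadd (h x) (h y).
Hypothesis coordL' : coordinates L' h' g'.
Hypothesis hf : forall x, h' (f x) = h x.

Local Notation Pt := (cPoints L' f).
Local Notation Ln := (cLines L L' f).

Definition to_flag (p : P * P') : flag := (h p.1, h' p.2).
Definition of_flag (x : flag) : P * P' := (g x.1, g' x.2).
Definition fline (x y : flag) : {set P * P'} := [set of_flag x; of_flag y; of_flag (fadd x y)].

Lemma to_flagK : cancel to_flag of_flag.
Proof.
case: coordL coordL' => _ hK _ _ [_ hK' _ _] [a b].
by rewrite /of_flag /= hK hK'.
Qed.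

Lemma of_flagK x : is_flag x -> to_flag (of_flag x) = x.
Proof.
case: coordL coordL' => _ _ gK _ [_ _ gK' _] /and3P[x1 x2 _].
by rewrite /to_flag /= gK // gK' //; case: x {x1 x2}.
Qed.

Lemma cPointsE p : (p \in Pt) = is_flag (to_flag p).
Proof.
case: coordL coordL' => hnz _ _ _ [hnz' _ _ perpE'].
by rewrite inE perpE' hf /is_flag /= hnz hnz'.
Qed.

Lemma of_flag_cPoints x : is_flag x -> of_flag x \in Pt.
Proof. by move=> xF; rewrite cPointsE of_flagK. Qed.

Lemma cPointsP p : p \in Pt -> exists2 x, is_flag x & p = of_flag x.
Proof. by rewrite cPointsE => pF; exists (to_flag p); rewrite ?to_flagK. Qed.

Lemma of_flag_eq x y : is_flag x -> is_flag y -> (of_flag x == of_flag y) = (x == y).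
Proof.
move=> xF yF; apply/eqP/eqP => [E|->//].
by rewrite -(of_flagK xF) E of_flagK.
Qed.

Lemma fgE v : v != vec0 -> f (g v) = g' v.
Proof.
by case: coordL coordL' => _ _ gK _ [_ hK' _ _] v0; rewrite -[LHS]hK' hf gK.
Qed.

(** If [symp x.1 y.1] is false, the line joining the two points has their sum as third point.
    Otherwise the three points are pairwise noncollinear, and [perpS_coordinates] shows that the
    triad is complete. *)
Lemma line_or_complete_triad x y (A := [set g x.1; g y.1; g (vadd x.1 y.1)]) :
  is_flag x -> is_flag y -> fadj x y -> (A \in L) || complete_triad L A.
Proof.
move=> xF yF xy; have [hnz hK gK perpE] := coordL.
have [zF _] := fadj_fadd xF yF xy.
case/and3P: (xF) => x1 x2 _; case/and3P: (yF) => y1 y2 _; case/and3P: (zF) => z1 z2 _.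
case/and4P: (xy) => xy1 xy2 _ _.
have g_neq v w : v != vec0 -> w != vec0 -> v != w -> g v != g w.
  by move=> v0 w0; apply: contraNneq => E; rewrite -(gK v) // E gK.
have nxy := g_neq _ _ x1 y1 xy1.
have nxz : g x.1 != g (vadd x.1 y.1) by rewrite g_neq // vaddKr_eq.
have nyz : g y.1 != g (vadd x.1 y.1) by rewrite g_neq // vaddC vaddKr_eq.
case s: (symp x.1 y.1); last first.
  have [|z l] := on_line_exists gqL nxy; first by rewrite /ncol perpE !gK // s.
  have := lineL l; rewrite !gK // => hz.
  by case/and4P: l => _ _ _; rewrite -[z]hK hz -/A => ->.
apply/orP; right; rewrite /complete_triad /triad card_set3 // (perpS_coordinates coordL) //.
rewrite (_ : #|_| = 3) ?andbT /=; last first.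
  rewrite card_set3 // g_neq ?vaddKr_eq //.
  by rewrite vaddC vaddKr_eq.
have nc u v : symp (h u) (h v) || (u == v) -> ~~ collinear L u v.
  case/orP=> [|/eqP->]; last by rewrite /collinear eqxx.
  by apply: contraTN => c; rewrite -perpE inE c orbT.
apply/forall_inP => u uA; apply/forall_inP => v vA; apply: nc.
move: uA vA; rewrite !inE => /orP[/orP[]|] /eqP-> /orP[/orP[]|] /eqP->;
  by rewrite ?eqxx ?orbT // !gK // ?sympDl ?sympDr ?sympxx ?[symp y.1 x.1]sympC s.
Qed.

Lemma fline_cLines x y : is_flag x -> is_flag y -> fadj x y -> fline x y \in Ln.
Proof.
move=> xF yF xy; have [hnz hK gK perpE] := coordL; have [hnz' hK' gK' perpE'] := coordL'.
have [zF xz] := fadj_fadd xF yF xy.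
have [_ yz] := fadj_fadd yF xF (etrans (fadjC _ _) xy); rewrite faddC in yz.
case/and3P: (xF) => x1 x2 _; case/and3P: (yF) => y1 y2 _; case/and3P: (zF) => z1 z2 _.
have neq u v : fadj u v -> u != v by apply: contraTneq => ->; rewrite fadj_irrefl.
have g_neq v w : v != vec0 -> w != vec0 -> v != w -> g v != g w.
  by move=> v0 w0; apply: contraNneq => E; rewrite -(gK v) // E gK.
have g'_neq v w : v != vec0 -> w != vec0 -> v != w -> g' v != g' w.
  by move=> v0 w0; apply: contraNneq => E; rewrite -(gK' v) // E gK'.
case/and4P: (xy) => xy1 xy2 _ _; case/and4P: (xz) => xz1 xz2 _ _.
case/and4P: (yz) => yz1 yz2 _ _.
rewrite inE /fline !imset_set3 !fgE //= (perpS_coordinates coordL') // eqxx andbT.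
rewrite !card_set3 ?g_neq ?g'_neq ?of_flag_eq ?neq // line_or_complete_triad //= andbT.
by apply/subsetP => p /setUP[/set2P[]|/set1P] ->; apply: of_flag_cPoints.
Qed.

(** Every first component on [l] is orthogonal to every second one, so [orth_plane], applied on each
    side, forces the third point to be the sum of the other two. *)
Lemma cLinesP l : l \in Ln ->
  exists x y, [/\ is_flag x, is_flag y, fadj x y & l = fline x y].
Proof.
have [hnz hK gK perpE] := coordL; have [hnz' hK' gK' perpE'] := coordL'.
rewrite inE => /and5P[/subsetP lPt /eqP/cards3P[p [q [r [pq pr qr El]]]]].
rewrite {}El in lPt *; rewrite !imset_set3.
move=> /eqP/set3_neq[pq1 pr1 qr1] _ /andP[/eqP/set3_neq[pq2 pr2 qr2] /eqP perpl].
have pPt : p \in Pt by apply: lPt; rewrite !inE eqxx.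
have qPt : q \in Pt by apply: lPt; rewrite !inE eqxx orbT.
have orth u v : u \in [set p; q; r] -> v \in [set p; q; r] -> ~~ symp (h u.1) (h' v.2).
  move=> ul vl; have : v.2 \in [set p.2; q.2; r.2].
    by rewrite -(imset_set3 snd); apply: imset_f.
  rewrite perpl in_perpS3 !perpE' !hf => /and3P[? ? ?].
  by move: ul; rewrite !inE => /orP[/orP[]|] /eqP->.
have pl : p \in [set p; q; r] by rewrite !inE eqxx.
have ql : q \in [set p; q; r] by rewrite !inE eqxx orbT.
have rl : r \in [set p; q; r] by rewrite !inE eqxx orbT.
exists (to_flag p), (to_flag q); rewrite -!cPointsE; split=> //.
  rewrite /fadj /= (can_eq hK) (can_eq hK') pq1 pq2 orth //=.
  by rewrite sympC orth.
rewrite /fline !to_flagK; congr (_ :|: [set _]); apply: (can_inj to_flagK).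
have E1 : h r.1 = vadd (h p.1) (h q.1).
  apply: (orth_plane (v1 := h' p.2) (v2 := h' q.2)); rewrite ?(can_eq hK) ?(can_eq hK') //;
    by rewrite ?[r.1 == _]eq_sym // sympC orth.
have E2 : h' r.2 = vadd (h' p.2) (h' q.2).
  apply: (orth_plane (v1 := h p.1) (v2 := h q.1)); rewrite ?(can_eq hK) ?(can_eq hK') //;
    by rewrite ?[r.2 == _]eq_sym // orth.
have rF : is_flag (to_flag r) by rewrite -cPointsE lPt.
have Er : to_flag r = fadd (to_flag p) (to_flag q) by rewrite /to_flag /fadd /= E1 E2.
by rewrite -Er to_flagK.
Qed.

Lemma flineC x y : fline x y = fline y x.
Proof. by rewrite /fline set3_swap faddC. Qed.

Lemma fline_fadd x y : fline x y = fline x (fadd x y).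
Proof. by rewrite /fline faddK -[RHS]set3_rot set3_swap -set3_rot. Qed.

(** Among [x], [y] and [fadd x y] each is the sum of the other two, so any two of them determine the
    line. *)
Lemma cLines_two l p q : l \in Ln -> p \in l -> q \in l -> p != q ->
  [/\ is_flag (to_flag p), is_flag (to_flag q), fadj (to_flag p) (to_flag q) &
      l = fline (to_flag p) (to_flag q)].
Proof.
case/cLinesP=> x [y [xF yF xy ->]].
have yx : fadj y x by rewrite fadjC.
have [zF xz] := fadj_fadd xF yF xy; have [_ yz] := fadj_fadd yF xF yx.
have zx : fadj (fadd x y) x by rewrite fadjC.
rewrite faddC in yz; have zy : fadj (fadd x y) y by rewrite fadjC.
have E1 := fline_fadd x y; have E2 := fline_fadd y x; rewrite faddC in E2.
have E := flineC.
move=> /setUP[/set2P[]|/set1P] -> /setUP[/set2P[]|/set1P] ->; rewrite ?eqxx // => _;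
  rewrite !of_flagK //; split=> //; by rewrite ?[fline (fadd _ _) _]E -?E1 -?E2 // E.
Qed.

Lemma collinear_cLines p q :
  collinear Ln p q = [&& p \in Pt, q \in Pt & fadj (to_flag p) (to_flag q)].
Proof.
rewrite !cPointsE; apply/andP/and3P => [[pq /existsP[l /and3P[lL pl ql]]]|[pF qF pq]].
  by have [] := cLines_two lL pl ql pq.
split; first by apply: contraTneq pq => ->; rewrite fadj_irrefl.
apply/existsP; exists (fline (to_flag p) (to_flag q)).
by rewrite fline_cLines // /fline !to_flagK !inE !eqxx orbT.
Qed.

Lemma in_ball_cLines p q k : p \in Pt ->
  (q \in ball Ln k p) = (q \in Pt) && (fdist (to_flag p) (to_flag q) <= k).
Proof.
move=> pPt; apply: (in_ball (d := fdist (to_flag p) \o to_flag)) => //=.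
- by move=> y z; rewrite collinear_cLines => /and3P[].
- move=> y yPt; rewrite fdist_eq0 -?cPointsE // eq_sym.
  exact/inj_eq/can_inj/to_flagK.
- move=> y z yPt; rewrite collinear_cLines => /and3P[_ zPt].
  by apply: fdist_step; rewrite -cPointsE.
- move=> y j yPt /fdist_pred[||z [zF zy dz]]; rewrite -?cPointsE //.
  by exists (of_flag z); rewrite collinear_cLines yPt of_flag_cPoints // of_flagK.
Qed.

Lemma dist_cLines p q : p \in Pt -> q \in Pt ->
  dist Ln p q = fdist (to_flag p) (to_flag q).
Proof.
move=> pPt qPt; apply: dist_ball => [|k]; last by rewrite in_ball_cLines ?qPt.
(* Distances are at most 3, and a single line already supplies three elements of the type. *)
apply: leq_trans (fdist_le3 _ _) _.
have pF : is_flag (to_flag p) by rewrite -cPointsE.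
have [y] : exists y, y \in line_reps (to_flag p).
  by case E: (line_reps _) (size_line_reps pF) => [|y s] // _; exists y; rewrite mem_head.
rewrite mem_filter mem_nbrs => /and3P[_ xy yF].
have := fline_cLines pF yF xy; rewrite inE => /and3P[_ /eqP <- _].
exact: max_card.
Qed.

Lemma cLines_near p l : p \in Pt -> l \in Ln -> p \notin l ->
  exists! y, y \in l /\ forall z, z \in l -> z != y -> dist Ln p y < dist Ln p z.
Proof.
case/cPointsP=> x xF -> /cLinesP[y [z [yF zF yz ->]]] nx.
have [tF _] := fadj_fadd yF zF yz.
have := fdist_line xF yF zF yz; rewrite !inE -!of_flag_eq //.
have -> : [|| of_flag x == of_flag y, of_flag x == of_flag z
  | of_flag x == of_flag (fadd y z)] = false.
  by apply: contraNF nx; rewrite !inE orbA.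
move=> /(_ isT).
(* Any of the three points may be the nearest; reordering the line puts it first. *)
suff near a b c : is_flag a -> is_flag b -> is_flag c ->
    fline y z = [set of_flag a; of_flag b; of_flag c] ->
    (fdist x a < fdist x b) && (fdist x a < fdist x c) ->
    exists! u, u \in fline y z /\ forall v, v \in fline y z -> v != u ->
      dist Ln (of_flag x) u < dist Ln (of_flag x) v.
  case/or3P; apply: near => //; rewrite /fline.
  - exact: set3_swap.
  - by rewrite -set3_rot.
move=> aF bF cF -> /andP[ab ac].
have dE w : is_flag w -> dist Ln (of_flag x) (of_flag w) = fdist x w.
  by move=> wF; rewrite dist_cLines ?of_flag_cPoints ?of_flagK.
exists (of_flag a); split; first split; first by rewrite !inE eqxx.
  by move=> v /setUP[/set2P[]|/set1P] ->; rewrite ?eqxx // !dE.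
move=> u [ul umin]; apply/eqP; apply: contraT => au.
have al : of_flag a \in [set of_flag a; of_flag b; of_flag c] by rewrite !inE eqxx.
have := umin _ al au; case/setUP: ul au => [/set2P[]|/set1P] ->; rewrite ?eqxx // => _;
  by rewrite !dE // ltnNge ltnW.
Qed.

(** Sending [y] to [fline x y] is a bijection from [line_reps x] onto the pencil. *)
Lemma card_pencil p : p \in Pt -> #|[set l in Ln | p \in l]| = 6.
Proof.
case/cPointsP=> x xF ->; rewrite -(size_line_reps xF) -(size_map (fline x)).
have repsP y : y \in line_reps x ->
    [/\ is_flag y, fadj x y & index y flags < index (fadd x y) flags].
  by rewrite mem_filter mem_nbrs => /and3P[].
have uniq_reps : uniq (map (fline x) (line_reps x)).
  rewrite map_inj_in_uniq ?filter_uniq ?flags_uniq // => y z.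
  move=> /repsP[yF xy iy] /repsP[zF xz iz] E.
  (* As [z] differs from [x], it is [y] or [fadd x y]; the latter contradicts the two index
     inequalities. *)
  have : of_flag z \in fline x y by rewrite E !inE eqxx orbT.
  have [tF _] := fadj_fadd xF yF xy.
  rewrite !inE !of_flag_eq // => /orP[/orP[]|] /eqP Ez //.
    by rewrite Ez fadj_irrefl in xz.
  by move: iz; rewrite Ez faddK ltnNge ltnW.
rewrite -(card_uniqP uniq_reps); apply: eq_card => l; rewrite inE.
apply/andP/mapP => [[lL xl]|[y /repsP[yF xy _] ->]]; last first.
  by rewrite fline_cLines // !inE eqxx.
have [y [yF xy El]] : exists y, [/\ is_flag y, fadj x y & l = fline x y].
  have [q ql nq] : exists2 q, q \in l & of_flag x != q.
    have [a [b [aF bF ab El]]] := cLinesP lL.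
    have n : of_flag a != of_flag b.
      by rewrite of_flag_eq //; apply: contraTneq ab => ->; rewrite fadj_irrefl.
    case: (eqVneq (of_flag x) (of_flag a)) => E.
      by exists (of_flag b); rewrite ?E // El !inE eqxx orbT.
    by exists (of_flag a); rewrite // El !inE eqxx.
  have [_ qF xq El] := cLines_two lL xl ql nq.
  by exists (to_flag q); rewrite of_flagK // in xq El.
have [zF xz] := fadj_fadd xF yF xy.
have yz : y != fadd x y.
  have [_] := fadj_fadd yF xF (etrans (fadjC _ _) xy); rewrite faddC.
  by apply: contraTneq => <-; rewrite fadj_irrefl.
case: (ltngtP (index y flags) (index (fadd x y) flags)) => iyz.
- by exists y; rewrite // mem_filter iyz mem_nbrs xy.
- exists (fadd x y); last by rewrite -fline_fadd.
  by rewrite mem_filter faddK iyz mem_nbrs xz.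
- by case/eqP: yz; apply: index_inj iyz; rewrite ?mem_flags.
Qed.

(** Although [perp] contains its own point, at distance 2 neither [p] nor [q] lies in the perp of
    the other, so only proper common neighbours are counted. *)
Lemma common_nbrs_cLines p q : p \in Pt -> q \in Pt -> dist Ln p q = 2 ->
  #|perp Ln p :&: perp Ln q| = size [seq z <- nbrs (to_flag p) | fadj (to_flag q) z].
Proof.
move=> pPt qPt; rewrite dist_cLines // => d2; set s := filter _ _.
have sP z : z \in s = [&& fadj (to_flag q) z, fadj (to_flag p) z & is_flag z].
  by rewrite mem_filter mem_nbrs.
have uniq_s : uniq (map of_flag s).
  rewrite map_inj_in_uniq ?filter_uniq ?flags_uniq // => y z.
  rewrite !sP => /and3P[_ _ yF] /and3P[_ _ zF] E.
  by apply/eqP; rewrite -of_flag_eq // E.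
have pF : is_flag (to_flag p) by rewrite -cPointsE.
have qF : is_flag (to_flag q) by rewrite -cPointsE.
have nadj : fadj (to_flag p) (to_flag q) = false.
  by apply: contra_eqF d2 => /fdist_fadj->.
have npq : (p == q) = false.
  by rewrite -(can_eq to_flagK) -fdist_eq0 // d2.
rewrite -(size_map of_flag) -(card_uniqP uniq_s); apply: eq_card => r.
rewrite !inE !collinear_cLines pPt qPt !andTb.
apply/andP/mapP => [[]|[z]]; last first.
  by rewrite sP => /and3P[qz pz zF] ->; rewrite of_flag_cPoints // of_flagK // qz pz !orbT.
case: eqP => [-> _|_ /andP[rPt pr]].
  by rewrite npq fadjC nadj /= andbF.
case: eqP => [E|_ /andP[_ qr]]; first by move: pr; rewrite E nadj.
by exists (to_flag r); rewrite ?to_flagK // sP qr pr -cPointsE.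
Qed.

End Construction.

Theorem theorem2p1 (P P' : finType) (L : {set {set P}}) (L' : {set {set P'}})
  (f : P -> P') :
  GQ22 L -> GQ22 L' -> geom_iso L L' f ->
  near_hexagon (cPoints L' f) (cLines L L' f) /\
  slim (cLines L L' f) /\
  dense (cPoints L' f) (cLines L L' f) /\
  has_parameters (cPoints L' f) (cLines L L' f) 2 5 [:: 1; 2].
Proof.
move=> gqL gqL' [[f' fK f'K] lineE].
have [h [g [coordL hline]]] := coordinates_exist gqL.
have [hnz hK gK perpE] := coordL.
(* Transporting the coordinates along [f] gives a point and its image the same vector. *)
pose h' := h \o f'; pose g' := f \o g.
have hf x : h' (f x) = h x by rewrite /h' /= fK.
have colE x y : collinear L' x y = collinear L (f' x) (f' y).
  rewrite /collinear (can_eq f'K); congr (_ && _); apply/existsP/existsP.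
    move=> [l /and3P[lL xl yl]]; exists (f' @: l).
    by rewrite lineE -imset_comp (eq_imset _ f'K) imset_id lL !imset_f.
  move=> [l /and3P[lL xl yl]]; exists (f @: l).
  by rewrite -lineE lL -[x]f'K -[y]f'K !imset_f.
have coordL' : coordinates L' h' g'.
  split=> [u|u|v /gK|x y]; rewrite /h' /g' /=; rewrite ?hK ?f'K ?fK //.
  by rewrite -perpE !inE colE (can_eq f'K).
pose to_f := to_flag h h'; pose of_f := of_flag g g'.
have distE := dist_cLines gqL coordL hline coordL' hf.
have nbrE := common_nbrs_cLines gqL coordL hline coordL' hf.
have ptE := cPointsE coordL coordL' hf.
have of_pt x : is_flag x -> of_f x \in cPoints L' f by apply: (of_flag_cPoints coordL coordL' hf).
have of_fK x : is_flag x -> to_f (of_f x) = x by apply: (of_flagK coordL coordL').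
have slimL : slim (cLines L L' f) by move=> l; rewrite inE => /and3P[_ /eqP].
have d2 p q : p \in cPoints L' f -> q \in cPoints L' f -> dist (cLines L L' f) p q = 2 ->
    #|perp (cLines L L' f) p :&: perp (cLines L L' f) q| \in [:: 2; 3].
  move=> pPt qPt d; rewrite nbrE //; apply: size_common_nbrs; rewrite -?ptE //.
  by rewrite -distE.
pose e1 := (true, false, false, false); pose e2 := (false, true, false, false).
pose e3 := (false, false, true, false); pose e4 := (false, false, false, true).
split; [|split=> //; split; [|split=> //; split; [|split]]].
- split; [split|split; [|split; [|split]]].
  + by move=> l; rewrite inE => /and3P[lPt /eqP->].
  + move=> l1 l2 p q l1L l2L pq p1 q1 p2 q2.
    have [_ _ _ ->] := cLines_two coordL coordL' hf l1L p1 q1 pq.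
    by have [_ _ _ ->] := cLines_two coordL coordL' hf l2L p2 q2 pq.
  + move=> p q pPt qPt; exists 3.
    by rewrite (in_ball_cLines gqL coordL hline coordL' hf) // qPt fdist_le3.
  + by move=> p q pPt qPt; rewrite distE // fdist_le3.
  (* The distance is 3 because [symp e1 e2] is true while [symp e1 e3] is false. *)
  + exists (of_f (e1, e1)), (of_f (e3, e2)).
    by rewrite !of_pt // distE ?of_pt // -/to_f !of_fK.
  + exact: cLines_near gqL coordL hline coordL' hf.
- by move=> p q pPt qPt /d2-/(_ pPt qPt); rewrite !inE => /orP[] /eqP->.
- exact: card_pencil gqL coordL hline coordL' hf.
- by move=> p q pPt qPt /d2-/(_ pPt qPt); rewrite !inE => /orP[] /eqP->.
- move=> t2; rewrite !inE => /orP[] /eqP->.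
  (* Both cross values of [symp] are false, but equal first components exclude adjacency; there are
     two common neighbours. *)
  + exists (of_f (e1, e1)), (of_f (e1, e3)).
    have d : dist (cLines L L' f) (of_f (e1, e1)) (of_f (e1, e3)) = 2.
      by rewrite distE ?of_pt // -/to_f !of_fK.
    by rewrite !of_pt // nbrE ?of_pt // -/to_f !of_fK.
  (* Both cross values of [symp] are true, which gives distance 2; there are three common
     neighbours. *)
  exists (of_f (e1, e1)), (of_f (e2, e2)).
  have d : dist (cLines L L' f) (of_f (e1, e1)) (of_f (e2, e2)) = 2.
    by rewrite distE ?of_pt // -/to_f !of_fK.
  by rewrite !of_pt // nbrE ?of_pt // -/to_f !of_fK.
Qed.
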